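(* Let $M$ be a complete length metric space. Then $\mathrm{Lip}_0(M)$ has the $\omega$-perfect Daugavet property.
   Context: All Banach spaces are real. $M$ is a pointed metric space, i.e. it has a distinguished base point $0\in M$, and $\mathrm{Lip}_0(M)$ is the Banach space of all real-valued Lipschitz functions on $M$ vanishing at $0$, with norm the least Lipschitz constant. A metric space $(M,d)$ is a length space if for every $x,y\in M$, $d(x,y)$ equals the infimum of the lengths of the rectifiable curves in $M$ joining $x$ and $y$. $B_X$ and $S_X$ denote the closed unit ball and unit sphere of a Banach space $X$. A slice of $B_X$ is a nonempty intersection of $B_X$ with an open half-space, i.e. a set $\{x\in B_X: f(x)>\sup f(B_X)-\alpha\}$ with $f\in X^*$, $\alpha>0$. $X$ has the $\omega$-perfect Daugavet property if for every countable family $\{y_n:n<\omega\}\subseteq S_X$ and every slice $S$ of $B_X$ there is $x\in S$ with $\|y_n+x\|=2$ for all $n<\omega$. *)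

(* Defs.v *)
From HB Require Import structures.
From mathcomp Require Import all_boot all_order all_algebra.
From mathcomp Require Import all_classical all_reals all_analysis.
From mathcomp Require Import lra.
Set Implicit Arguments.
Unset Strict Implicit.
Unset Printing Implicit Defensive.
Import Order.TTheory GRing.Theory Num.Theory.
Import numFieldNormedType.Exports.
Local Open Scope classical_set_scope.
Local Open Scope ring_scope.

(* The distinguished base point, written 0 on paper, is [point]. *)
#[short(type="pointedMetricType")]
HB.structure Definition PointedMetric (K : numDomainType) :=
  {M of Metric K M & isPointed M}.

#[short(type="completePointedMetricType")]
HB.structure Definition CompletePointedMetric (K : numDomainType) :=
  {M of PointedMetric K M & Complete M}.

Section length_space.
Context {R : realType} {M : metricType R}.

Definition polygonal_length (a b : R) (g : R -> M) (s : seq R) : R :=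
  let G := g \o nth b (a :: s) in \sum_(0 <= n < size s) mdist (G n) (G n.+1).

(* [itv_partition a b s] says that [a :: s] is a partition of [a, b]; the first
   point [a] is not listed in [s]. *)
Definition curve_length (a b : R) (g : R -> M) : \bar R :=
  ereal_sup [set (polygonal_length a b g s)%:E | s in itv_partition a b].

Definition rectifiable_curve (x y : M) (g : R -> M) : Prop :=
  [/\ {within `[0, 1], continuous g}, g 0 = x, g 1 = y
    & (curve_length 0 1 g < +oo)%E].

End length_space.

(* The infimum is taken in the extended reals: two points joined by no
   rectifiable curve are at infinite length distance. *)
Definition length_space {R : realType} (M : metricType R) : Prop :=
  forall x y : M, (mdist x y)%:E =
    ereal_inf [set curve_length 0 1 g | g in rectifiable_curve x y].

Section lip0_pred.
Context (R : realType) (M : pointedMetricType R).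

Definition is_lip (k : R) (f : M -> R) : Prop :=
  forall x y : M, `|f x - f y| <= k * mdist x y.

Definition lip0_pred : {pred M -> R^o} :=
  mem [set f : M -> R^o | f point = 0 /\ exists k, is_lip k f].

Lemma lip0_submod_closed : submod_closed lip0_pred.
Proof.
split.
  rewrite inE/=; split=> //; exists 0 => x y.
  by rewrite /= subrr normr0 mul0r.
move=> a f g; rewrite !inE/= => -[f0 [k fk]] [g0 [l gl]]; split.
  by rewrite !fctE f0 g0 scaler0 addr0.
exists (`|a| * k + l) => x y; rewrite !fctE /= opprD addrACA -scalerBr mulrDl.
rewrite (le_trans (ler_normD _ _))// lerD// normrZ -mulrA.
by rewrite ler_wpM2l.
Qed.

HB.instance Definition _ :=
  GRing.isSubmodClosed.Build R (M -> R^o) lip0_pred lip0_submod_closed.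

(* The codomain is [R^o], i.e. R as a normed module over itself, so that the
   pointwise operations come from [M -> R^o]. *)
Record Lip0 := MkLip0 {
  lip0_fun :> M -> R^o;
  lip0_funP : lip0_fun \in lip0_pred }.

HB.instance Definition _ := [isSub for lip0_fun].
HB.instance Definition _ := [Choice of Lip0 by <:].
HB.instance Definition _ := [SubChoice_isSubLmodule of Lip0 by <:].

End lip0_pred.

Section lip0_norm.
Context {R : realType} {M : pointedMetricType R}.
Implicit Types f g : Lip0 M.

(* The infimum is attained (lemma [lip_normP] below); the condition [0 <= k]
   only matters when M is reduced to its base point. *)
Definition lip_norm f : R := inf [set k | 0 <= k /\ is_lip k f].

Lemma lip0_point f : f point = 0.
Proof. by have := lip0_funP f; rewrite inE => -[]. Qed.

Lemma lip0P f g : (forall x, f x = g x) -> f = g.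
Proof. by move=> fg; apply/val_inj/funext. Qed.

Lemma lip0_has_inf f : has_inf [set k | 0 <= k /\ is_lip k f].
Proof.
split; last by exists 0 => k [].
have := lip0_funP f; rewrite inE => -[_ [k fk]].
exists `|k|; split=> // x y; rewrite (le_trans (fk x y))//.
by rewrite ler_wpM2r ?mdist_ge0// ler_norm.
Qed.

Lemma lip_norm_ge0 f : 0 <= lip_norm f.
Proof. by apply: lb_le_inf; [case: (lip0_has_inf f)|move=> k []]. Qed.

Lemma lip_norm_le f k : 0 <= k -> is_lip k f -> lip_norm f <= k.
Proof. by move=> k0 fk; apply: ge_inf => //; case: (lip0_has_inf f). Qed.

Lemma lip_normP f : is_lip (lip_norm f) f.
Proof.
move=> x y; have [->|xy] := eqVneq x y;
  first by rewrite subrr normr0 mdistxx mulr0.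
have d0 : 0 < mdist x y by rewrite mdist_gt0.
rewrite -ler_pdivrMr//; apply: lb_le_inf; first by case: (lip0_has_inf f).
by move=> k [_ fk]; rewrite ler_pdivrMr.
Qed.

Lemma ler_lip_normD f g : lip_norm (f + g) <= lip_norm f + lip_norm g.
Proof.
apply: lip_norm_le; first by rewrite addr_ge0// lip_norm_ge0.
move=> x y; rewrite [(f + g) x]/(f x + g x) [(f + g) y]/(f y + g y).
by rewrite opprD addrACA mulrDl (le_trans (ler_normD _ _))// lerD// lip_normP.
Qed.

Let lip_normZ_le (a : R) f : lip_norm (a *: f) <= `|a| * lip_norm f.
Proof.
apply: lip_norm_le; first by rewrite mulr_ge0// lip_norm_ge0.
move=> x y; rewrite [(a *: f) x]/(a * f x) [(a *: f) y]/(a * f y).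
by rewrite -mulrBr normrM -mulrA ler_wpM2l// lip_normP.
Qed.

Lemma lip_normZ (a : R) f : lip_norm (a *: f) = `|a| * lip_norm f.
Proof.
apply/eqP; rewrite eq_le lip_normZ_le/=.
have [->|a0] := eqVneq a 0; first by rewrite normr0 mul0r lip_norm_ge0.
have := lip_normZ_le a^-1 (a *: f).
by rewrite scalerA mulVf// scale1r normfV ler_pdivlMl ?normr_gt0.
Qed.

Lemma lip_norm_eq0 f : lip_norm f = 0 -> f = 0.
Proof.
move=> f0; apply: lip0P => x; have := lip_normP f x point.
by rewrite f0 mul0r lip0_point subr0 normr_le0 => /eqP.
Qed.

HB.instance Definition _ := Lmodule_isNormed.Build R (Lip0 M)
  ler_lip_normD lip_normZ lip_norm_eq0.

Lemma lip0_normE f : `|f| = lip_norm f. Proof. by []. Qed.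

Lemma lip0_cauchy_cvg (F : set_system (Lip0 M)) :
  ProperFilter F -> cauchy F -> cvg F.
Proof.
move=> FF /cauchy_ballP Fc.
have Flip (e : R) : 0 < e ->
    \forall f & h \near F,
      is_lip e (fun x : M => (f : Lip0 M) x - (h : Lip0 M) x).
  move=> e0; apply: filterS (Fc _ e0) => -[f h] /=.
  rewrite -ball_normE/= => fh x y; have := lip_normP (f - h) x y.
  move=> /le_trans; apply.
  by rewrite ler_wpM2r ?mdist_ge0// ltW.
pose G x : R := lim (((h : Lip0 M) x : R) @[h --> F]).
have FG x : ((h : Lip0 M) x : R) @[h --> F] --> G x.
  apply: cauchy_cvg; apply/cauchy_ballP => e e0.
  pose D := mdist x point + 1.
  have D0 : 0 < D by rewrite ltr_wpDl// mdist_ge0.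
  rewrite !near_simpl/=.
  apply: filterS (Flip _ (divr_gt0 e0 D0)) => -[f h]/= fh.
  rewrite -ball_normE/=.
  have := fh x point.
  rewrite !lip0_point !subr0 => /le_lt_trans; apply.
  by rewrite mulrAC ltr_pdivrMr// ltr_pM2l// ltrDl.
have GE (e : R) : 0 < e ->
    \forall f \near F, is_lip e (fun x : M => (f : Lip0 M) x - G x).
  move=> e0; have := Flip _ e0.
  move=> /nearP_dep; apply: filterS => f fh x y.
  have c : `|(f x - h x) - (f y - h y)| @[h --> F] -->
           `|(f x - G x) - (f y - G y)|.
    apply: cvg_norm; apply: cvgB; apply: cvgB; by [exact: cvg_cst|exact: FG].
  rewrite -(cvg_lim _ c)//; apply: limr_le;
    first by apply/cvg_ex; eexists; exact: c.
  by apply: filterS fh => h /(_ x y).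
have G_in : (G : M -> R^o) \in @lip0_pred R M.
  rewrite inE/=; split.
    apply: cvg_lim => //; under eq_fun do rewrite lip0_point.
    exact: cvg_cst.
  have /filter_ex[f fG] := GE _ ltr01; exists (1 + lip_norm f) => x y.
  rewrite mulrDl (_ : G x - G y = - ((f x - G x) - (f y - G y)) + (f x - f y)).
    by rewrite (le_trans (ler_normD _ _))// normrN lerD// lip_normP.
  by rewrite !opprB addrACA addrC -!addrA; congr (_ + _); lra.
apply/cvg_ex; exists (MkLip0 G_in).
apply/cvgrPdist_le => /= e e0.
have := GE _ e0; apply: filterS => f fG.
rewrite distrC lip0_normE; apply: lip_norm_le; first exact: ltW.
exact: fG.
Qed.

HB.instance Definition _ :=
  Uniform_isComplete.Build (Lip0 M) lip0_cauchy_cvg.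

End lip0_norm.

Section omega_perfect_Daugavet.
Context {R : realType}.

Definition unit_ball (X : normedModType R) : set X := [set x | `|x| <= 1].
Definition unit_sphere (X : normedModType R) : set X := [set x | `|x| = 1].

Definition slice (X : normedModType R) (f : X -> R) (alpha : R) : set X :=
  [set x | unit_ball x /\ sup (f @` @unit_ball X) - alpha < f x].

Definition is_slice (X : normedModType R) (S : set X) : Prop :=
  exists (f : {scalar X}) (alpha : R),
    [/\ continuous (f : X -> R), 0 < alpha & S = slice f alpha].

Definition omega_perfect_Daugavet (X : completeNormedModType R) : Prop :=
  forall (y : nat -> X) (S : set X),
    (forall n, unit_sphere (y n)) -> is_slice S ->
    exists2 x, S x & forall n, `|y n + x| = 2.

End omega_perfect_Daugavet.

(* Main.v *)
Require Import Defs.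
From mathcomp Require Import all_boot all_order all_algebra.
From mathcomp Require Import all_classical all_reals all_analysis.
From mathcomp Require Import ring lra.

(* Given [f] of norm < 1 in the slice, one pastes, around countably many points
   [p_t], a scaled copy of the unit function [y_n] onto [f]. With a logarithmic
   cutoff this costs arbitrarily little in the Lipschitz constant, and if [y_n]
   has slope close to 1 on a pair of points very near [p_t], so has the glued
   function. Each new patch avoids the earlier pairs, but may lie inside an
   earlier patch.
   The gluing is linear in the functions glued, so the perturbations of [f]
   obtained from disjoint sets of patches add up, and every set of patches gives
   a function in the unit ball. Splitting the patches into infinitely many
   families, each of them serving every [y_n], the functional must be almost
   unchanged by one of the families, or it would be unbounded on the ball. *)

Set Implicit Arguments.
Unset Strict Implicit.
Unset Printing Implicit Defensive.
Import Order.TTheory GRing.Theory Num.Theory.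
Import numFieldNormedType.Exports.
Local Open Scope classical_set_scope.
Local Open Scope ring_scope.

(** * Curve length, and steep points of Lipschitz functions along curves *)

Section curves.
Context {R : realType} {M : metricType R}.
Implicit Types (g : R -> M) (a b c : R).

(** In [polygonal_length] the right end point is only the default value of [nth], and all indices
    are in range; hence [b] is arbitrary here. *)
Lemma polygonal_length_rcons a b c g s :
  polygonal_length a c g (rcons s c) =
  polygonal_length a b g s + mdist (g (last a s)) (g c).
Proof.
rewrite /polygonal_length size_rcons big_nat_recr//=; congr (_ + _).
  apply: eq_big_nat => i /andP[_ ilt]; congr (mdist (g _) (g _)).
    rewrite -rcons_cons nth_rcons/= ltnS (ltnW ilt).
    by apply: set_nth_default => /=; rewrite ltnS ltnW.
  by rewrite nth_rcons ilt; apply: set_nth_default.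
congr (mdist (g _) (g _)); last by rewrite nth_rcons ltnn eqxx.
rewrite -rcons_cons nth_rcons/= ltnSn.
by rewrite (last_nth c).
Qed.

Lemma polygonal_length_ge0 a b g s : 0 <= polygonal_length a b g s.
Proof. by apply: sumr_ge0 => i _; exact: mdist_ge0. Qed.

Lemma curve_length_ge0 a b g : a <= b -> (0 <= curve_length a b g)%E.
Proof.
rewrite le_eqVlt => /predU1P[<-|ab].
  apply: ereal_sup_ubound; exists [::]; first by split => //=.
  by rewrite /polygonal_length big_geq.
apply: (@le_trans _ _ (polygonal_length a b g [:: b])%:E).
  by rewrite lee_fin polygonal_length_ge0.
by apply: ereal_sup_ubound; exists [:: b] => //; split => //=; rewrite ?ab.
Qed.

Lemma curve_length_extend a b c g : b <= c ->
  (curve_length a b g + (mdist (g b) (g c))%:E <= curve_length a c g)%E.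
Proof.
(* Partitions are strictly increasing, so [c] can be appended to one only when [b < c]. *)
rewrite le_eqVlt => /predU1P[<-|bc]; first by rewrite mdistxx adde0.
rewrite -leeBrDr//; apply: ge_ereal_sup => _ [s [ps /eqP ls] <-].
rewrite leeBrDr// -EFinD.
have := polygonal_length_rcons a b c g s; rewrite ls => <-.
apply: ereal_sup_ubound; exists (rcons s c) => //; split.
  by rewrite rcons_path ps ls.
by rewrite last_rcons.
Qed.

Lemma within_itv_continuous_mdist g a b c : {within `[a, b], continuous g} ->
  a <= c <= b -> forall e, 0 < e ->
  exists2 d, 0 < d & forall t, a <= t <= b -> `|c - t| < d ->
    mdist (g c) (g t) < e.
Proof.
move=> /subspace_continuousP cg cab e e0.
have /cg/(_ (ball (g c) e)) : [set` `[a, b]] c by rewrite /= in_itv.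
move=> /(_ (nbhsx_ballx _ _ e0)) [d /= d0 H]; exists d => // t tab ct.
have := H t ct; rewrite /= in_itv/= => /(_ tab).
by rewrite ballEmdist.
Qed.

End curves.

(* A continuous function minus a nondecreasing one has no upward jump, so it
   takes the value [k] at the last time it is at most [k]. *)
Lemma last_crossing (R : realType) (u l : R -> R) (k : R) :
  (forall c, 0 <= c <= 1 -> forall e, 0 < e -> exists2 d, 0 < d &
     forall t, 0 <= t <= 1 -> `|c - t| < d -> `|u c - u t| < e) ->
  (forall s t, 0 <= s -> s <= t -> t <= 1 -> l s <= l t) ->
  u 0 - l 0 <= k -> k < u 1 - l 1 ->
  exists c, [/\ 0 <= c < 1, u c - l c = k &
    forall t, c < t <= 1 -> k < u t - l t].
Proof.
move=> cu nl u0 u1; pose S := [set t | 0 <= t <= 1 /\ u t - l t <= k].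
have S0 : S 0 by split=> //; rewrite lexx ler01.
have hS : has_sup S.
  by split; [exists 0|exists 1 => t [/andP[]]].
pose c := sup S; have c0 : 0 <= c by apply: ub_le_sup => //; case: hS.
have c1 : c <= 1 by apply: ge_sup; [case: hS|move=> t [/andP[]]].
have c01 : 0 <= c <= 1 by rewrite c0 c1.
have gtc t : c < t <= 1 -> k < u t - l t.
  move=> /andP[ct t1]; rewrite ltNge; apply/negP => tk.
  have : t <= c.
    by apply: ub_le_sup; [case: hS|split; rewrite // t1 (le_trans c0)// ltW].
  by rewrite leNgt ct.
(* The supremum belongs to [S]: otherwise, as [l] is at most [l c] on the left of [c], continuity of
   [u] would keep [u - l] above [k] just before [c]. *)
have ck : u c - l c <= k.
  rewrite leNgt; apply/negP => kc.
  have e0 : 0 < u c - l c - k by rewrite subr_gt0.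
  have [d d0 H] := cu c c01 _ e0.
  have [t [t01 tk] td] := sup_adherent d0 hS.
  have tc : t <= c by apply: ub_le_sup => //; case: hS.
  have := H t t01; rewrite ger0_norm ?subr_ge0//.
  have -> : c - t < d by move: td; rewrite -/c; lra.
  move=> /(_ isT) /ltr_normlP[_]; have := nl t c; case/andP: t01 => -> _.
  by rewrite tc c1 => /(_ isT isT isT); lra.
have cl1 : c < 1.
  by rewrite lt_neqAle c1 andbT; apply/eqP => ce; move: ck; rewrite ce; lra.
exists c; split => //; first by rewrite c0.
(* A value below [k] would persist just after [c], where [l] is at least [l c]; this contradicts
   [gtc]. *)
apply/eqP; rewrite eq_le ck leNgt; apply/negP => kc.
have e0 : 0 < k - (u c - l c) by rewrite subr_gt0.
have [d d0 H] := cu c c01 _ e0.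
pose t := Num.min 1 (c + d / 2).
have ct : c < t by rewrite lt_min cl1 ltrDl divr_gt0.
have t1 : t <= 1 by rewrite ge_min lexx.
have := H t; rewrite t1 (le_trans c0 (ltW ct)) => /(_ isT).
rewrite distrC gtr0_norm ?subr_gt0//.
have -> : t - c < d.
  have : t <= c + d / 2 by rewrite ge_min lexx orbT.
  lra.
move=> /(_ isT) /ltr_normlP[+ _]; have := gtc t; rewrite ct t1 => /(_ isT).
have := nl c t c0 (ltW ct) t1; lra.
Qed.

(* Along a curve from [a] to [b] of length less than [(y b - y a) / k], the
   function [y] minus [k] times arc length crosses every value in an interval
   for a last time; there [y] is steep to the right. The points obtained from
   different values are distinct, so some of them avoid [F]. *)
Lemma steep_points (R : realType) (M : pointedMetricType R) (y : M -> R)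
    (L k : R) (F : seq M) :
  length_space M -> is_lip L y -> 0 < k -> ~ is_lip k y ->
  exists2 p, p \notin F & forall e, 0 < e ->
    exists v, [/\ 0 < mdist p v, mdist p v < e & k * mdist p v <= y v - y p].
Proof.
move=> lM yL k0 yk.
have [a [b ab]] : exists a b, k * mdist a b < y b - y a.
  apply: contrapT => H; apply: yk => a b.
  rewrite ler_norml; apply/andP; split; rewrite leNgt; apply/negP => h;
    apply: H; [exists a, b|exists b, a; rewrite metric_sym]; lra.
have L0 : 0 < L + 1.
  have := yL a b; have : k * mdist a b < `|y a - y b|.
    by rewrite (lt_le_trans ab)// distrC ler_norm.
  have [->|nab] := eqVneq a b; first by rewrite subrr normr0 mdistxx mulr0; lra.
  have d0 : 0 < mdist a b by rewrite mdist_gt0.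
  move=> h1 h2; have := lt_le_trans h1 h2; rewrite ltr_pM2r//; lra.
have : (ereal_inf [set curve_length 0 1 g | g in rectifiable_curve a b] <
        ((y b - y a) / k)%:E)%E.
  by rewrite -lM lte_fin ltr_pdivlMr// mulrC.
move=> /ereal_inf_lt[_ /= [g [cg g0 g1 gfin] <-] glt].
have fin t : 0 <= t <= 1 -> curve_length 0 t g \is a fin_num.
  move=> /andP[t0 t1]; rewrite ge0_fin_numE ?curve_length_ge0//.
  apply: le_lt_trans gfin; apply: le_trans (curve_length_extend _ _ t1).
  by rewrite leeDl// lee_fin mdist_ge0.
pose l t := fine (curve_length 0 t g).
have lext s t : 0 <= s -> s <= t -> t <= 1 -> l s + mdist (g s) (g t) <= l t.
  move=> s0 st t1; rewrite -lee_fin EFinD !fineK ?curve_length_extend//.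
    by apply: fin; rewrite (le_trans s0).
  by apply: fin; rewrite s0 (le_trans st).
have l0 : 0 <= l 0 by rewrite fine_ge0// curve_length_ge0.
have l1 : k * l 1 < y b - y a.
  by rewrite mulrC -ltr_pdivlMr// -lte_fin fineK// fin// ler01 lexx.
have ycont c : 0 <= c <= 1 -> forall e, 0 < e -> exists2 d, 0 < d &
    forall t, 0 <= t <= 1 -> `|c - t| < d -> `|y (g c) - y (g t)| < e.
  move=> c01 e e0.
  have [d d0 H] := within_itv_continuous_mdist cg c01 (divr_gt0 e0 L0).
  exists d => // t t01 ct; rewrite (le_lt_trans (yL _ _))//.
  apply: (@le_lt_trans _ _ ((L + 1) * mdist (g c) (g t))).
    by rewrite ler_wpM2r ?mdist_ge0// lerDl.
  by rewrite mulrC -ltr_pdivlMr// H.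
pose Q h c := [/\ 0 <= c < 1, y (g c) - k * l c = h &
    forall t, c < t <= 1 -> h < y (g t) - k * l t].
have Qex h : y a <= h < y b - k * l 1 -> exists c, Q h c.
  move=> /andP[ah hb].
  apply: (@last_crossing _ (y \o g) (fun t => k * l t)) => //=.
  - move=> s t s0 st t1; rewrite ler_pM2l//.
    by have := lext s t s0 st t1; have := mdist_ge0 (g s) (g t); lra.
  - by rewrite g0; have := mulr_ge0 (ltW k0) l0; lra.
  - by rewrite g1.
(* The curve may revisit a point, so different parameters are not enough: the points [g c] are told
   apart by their values under [y]. *)
have Qmono h h' c c' : h < h' -> Q h c -> Q h' c' -> y (g c) < y (g c').
  move=> hh [/andP[c0 c1] ch gtc] [/andP[c'0 c'1] ch' gtc'].
  have cc : c < c'.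
    rewrite ltNge; apply/negP; rewrite le_eqVlt => /predU1P[e|c'c].
      by move: ch'; rewrite e; lra.
    have := gtc' c; rewrite c'c (ltW c1) => /(_ isT); lra.
  have := lext c c' c0 (ltW cc) (ltW c'1); have := mdist_ge0 (g c) (g c').
  move=> d0 h1; have : k * l c <= k * l c' by rewrite ler_pM2l//; lra.
  lra.
pose m := size F; pose w := y b - k * l 1 - y a.
have w0 : 0 < w by rewrite /w; lra.
(* These are [size F + 1] equally spaced levels below [y b - k * l 1]; by pigeonhole, the crossing
   point of one of them avoids [F]. *)
pose h (i : nat) := y a + w * (i%:R / m.+1%:R).
have hmono i j : (i < j)%N -> h i < h j.
  by move=> ij; rewrite ltrD2l ltr_pM2l// ltr_pM2r ?invr_gt0// ltr_nat.
have /choice[c cQ] : forall i, exists c, (i < m.+1)%N -> Q (h i) c.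
  move=> i; have [im|im] := ltnP i m.+1; last by exists 0.
  have [|ci ciQ] := Qex (h i); last by exists ci.
  rewrite /h lerDl mulr_ge0 ?(ltW w0)// ?divr_ge0//=.
  rewrite -ltrBrDl -/w gtr_pMr// ltr_pdivrMr// mul1r ltr_nat//.
have : ~~ all (mem F) [seq g (c i) | i <- iota 0 m.+1].
  apply/negP => /allP sF; suff : (m.+1 <= size F)%N by rewrite ltnn.
  rewrite -(size_iota 0 m.+1) -(size_map (g \o c)); apply: uniq_leq_size.
    rewrite map_inj_in_uniq ?iota_uniq// => i j.
    rewrite !mem_iota !add0n/= => im jm e.
    case: (ltngtP i j) => // /hmono ij.
      by have := Qmono _ _ _ _ ij (cQ _ im) (cQ _ jm); rewrite e ltxx.
    by have := Qmono _ _ _ _ ij (cQ _ jm) (cQ _ im); rewrite e ltxx.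
  exact: sF.
move=> /allPn[_ /mapP[i +] ->]; rewrite mem_iota/= add0n => im pF.
have {cQ} [/andP[c0 c1] ch gtc] := cQ _ im; exists (g (c i)) => // e e0.
have c01 : 0 <= c i <= 1 by rewrite c0 ltW.
have [d d0 H] := within_itv_continuous_mdist cg c01 e0.
pose t := Num.min 1 (c i + d / 2).
have ct : c i < t by rewrite lt_min c1 ltrDl divr_gt0.
have t1 : t <= 1 by rewrite ge_min lexx.
have td : t <= c i + d / 2 by rewrite ge_min lexx orbT.
have := gtc t; rewrite ct t1 => /(_ isT) tgt.
have yd : k * mdist (g (c i)) (g t) < y (g t) - y (g (c i)).
  have : k * (l (c i) + mdist (g (c i)) (g t)) <= k * l t.
    by rewrite ler_pM2l// lext// ltW.
  rewrite mulrDr; lra.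
exists (g t); split; [|apply: H|exact: ltW].
- rewrite mdist_gt0; apply/eqP => E; move: yd; rewrite E mdistxx mulr0 subrr.
  by rewrite ltxx.
- by rewrite t1 (le_trans c0)// ltW.
- by rewrite distrC gtr0_norm ?subr_gt0//; lra.
Qed.

(** * The logarithmic cutoff *)

Section cutoff.
Context {R : realType}.
Implicit Types e rho a b : R.

(** Solves [e * ln (rho / r) = 1] for [r]: the cutoff leaves 0 at this radius and reaches 1 exactly
    at [rho]. *)
Definition inner_radius e rho := rho * expR (- e^-1).

(* Logarithmic, so that multiplying it by a Lipschitz function vanishing at
   distance 0 costs only [e] in the Lipschitz constant. *)
Definition cutoff e rho a :=
  Num.min 1 (e * ln (Num.max a (inner_radius e rho) / inner_radius e rho)).

Lemma inner_radius_gt0 e rho : 0 < rho -> 0 < inner_radius e rho.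
Proof. by move=> rho0; rewrite mulr_gt0// expR_gt0. Qed.

Lemma cutoff_inner e rho a : 0 < rho -> a <= inner_radius e rho ->
  cutoff e rho a = 0.
Proof.
move=> rho0 ar; rewrite /cutoff max_r// divff ?gt_eqF ?inner_radius_gt0//.
by rewrite ln1 mulr0 min_r.
Qed.

Lemma cutoff_outer e rho a : 0 < e -> 0 < rho -> rho <= a ->
  cutoff e rho a = 1.
Proof.
move=> e0 rho0 ra; have r0 := inner_radius_gt0 e rho0.
rewrite /cutoff min_l// -ler_pdivrMl// mulr1.
rewrite -[leLHS]expRK ler_ln ?posrE ?expR_gt0//; last first.
  by rewrite divr_gt0// lt_max r0 orbT.
rewrite ler_pdivlMr// /inner_radius mulrCA -expRD subrr expR0 mulr1.
by rewrite le_max ra.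
Qed.

Lemma cutoff_ge0 e rho a : 0 < e -> 0 < rho -> 0 <= cutoff e rho a.
Proof.
move=> e0 rho0; have r0 := inner_radius_gt0 e rho0.
rewrite le_min ler01 mulr_ge0 ?(ltW e0)// ln_ge0//.
by rewrite ler_pdivlMr// mul1r le_max lexx orbT.
Qed.

Lemma cutoff_le1 e rho a : cutoff e rho a <= 1.
Proof. by rewrite ge_min lexx. Qed.

(** From [ln z <= z - 1] at [z = b' / a'], where [a'] and [b'] are [a] and [b] raised to at least
    the inner radius; truncation at 1 only decreases the variation. *)
Lemma cutoff_var e rho a b : 0 < e -> 0 < rho -> 0 <= a <= b ->
  `|cutoff e rho b - cutoff e rho a| * a <= e * (b - a).
Proof.
move=> e0 rho0 /andP[a0 ab]; have r0 := inner_radius_gt0 e rho0.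
rewrite /cutoff; set r := inner_radius e rho in r0 *.
set a' := Num.max a r; set b' := Num.max b r.
have a'0 : 0 < a' by rewrite lt_max r0 orbT.
have b'0 : 0 < b' by rewrite lt_max r0 orbT.
have ab' : a' <= b' by rewrite ge_max !le_max ab lexx orbT.
have aa' : a <= a' by rewrite le_max lexx.
have ba' : b' - a' <= b - a.
  by rewrite /b' /a'; case: (leP b r); case: (leP a r); lra.
have lnE : ln (b' / r) = ln (a' / r) + ln (b' / a').
  rewrite -lnM ?posrE ?divr_gt0//; congr ln.
  by rewrite [RHS]mulrC mulrA divfK// gt_eqF.
have ln0 : 0 <= e * ln (b' / a').
  by rewrite mulr_ge0 ?(ltW e0)// ln_ge0// ler_pdivlMr// mul1r.
have lna : e * ln (b' / a') * a <= e * (b - a).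
  rewrite -mulrA ler_pM2l//; apply: le_trans ba'.
  have -> : b' - a' = (b' / a' - 1) * a'.
    by rewrite mulrBl divfK ?mul1r// gt_eqF.
  apply: ler_pM => //.
    by rewrite ln_ge0// ler_pdivlMr// mul1r.
  have := @le_ln1Dx R (b' / a' - 1); rewrite [1 + _]addrC subrK; apply.
  by rewrite ltrBrDl subrr divr_gt0.
apply: le_trans lna; rewrite ler_wpM2r// lnE mulrDr.
set u := e * ln (a' / r); set w := e * ln (b' / a') in ln0 *.
by case: (leP 1 u); case: (leP 1 (u + w)); rewrite ler_norml; lra.
Qed.

End cutoff.

(** * Gluing one Lipschitz function into another around a point *)

Section glue.
Context {R : realType} {M : pointedMetricType R}.
Implicit Types (e rho : R) (p x : M) (g h : M -> R).

(** The increments from [p] are interpolated: they vanish at [p], so [cutoff_var] absorbs the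
    variation of the cutoff. *)
Definition glue e rho p g h x :=
  let c := cutoff e rho (mdist x p) in
  g p + c * (g x - g p) + (1 - c) * (h x - h p).

Lemma glue_inner e rho p g h x : 0 < rho ->
  mdist x p <= inner_radius e rho -> glue e rho p g h x = g p + (h x - h p).
Proof. by move=> rho0 xp; rewrite /glue cutoff_inner//; ring. Qed.

Lemma glue_outer e rho p g h x : 0 < e -> 0 < rho ->
  rho <= mdist x p -> glue e rho p g h x = g x.
Proof. by move=> e0 rho0 xp; rewrite /glue cutoff_outer//; ring. Qed.

Lemma glue_close e rho p g h x : 0 < e -> 0 < rho ->
  is_lip 1 g -> is_lip 1 h -> `|glue e rho p g h x - g x| <= 2 * rho.
Proof.
move=> e0 rho0 gl hl; have [xp|xp] := leP rho (mdist x p).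
  by rewrite glue_outer// subrr normr0; lra.
rewrite /glue; set c := cutoff _ _ _.
have c0 : 0 <= c by exact: cutoff_ge0.
have c1 : c <= 1 by exact: cutoff_le1.
have -> : g p + c * (g x - g p) + (1 - c) * (h x - h p) - g x =
  (1 - c) * ((h x - h p) - (g x - g p)) by ring.
rewrite normrM ger0_norm ?subr_ge0//.
have h1 : `|h x - h p - (g x - g p)| <= 2 * rho.
  by have := ler_normB (h x - h p) (g x - g p); have := gl x p;
    have := hl x p; lra.
by apply: le_trans h1; apply: ler_piMl => //; rewrite gerBl.
Qed.

Lemma is_lip_le k k' g : k <= k' -> is_lip k g -> is_lip k' g.
Proof.
by move=> kk gk x y; rewrite (le_trans (gk x y))// ler_wpM2r ?mdist_ge0.
Qed.

(** The difference of two values is a convex combination of the differences of [g] and [h], plus the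
    variation of the cutoff times increments at [y] of size at most [2 * mdist y p]. Taking [y] as
    the point closer to [p] makes [cutoff_var] applicable. *)
Lemma is_lip_glue e rho p g h k : 0 < e -> 0 < rho -> k <= 1 ->
  is_lip k g -> is_lip k h -> is_lip (k + 2 * e) (glue e rho p g h).
Proof.
move=> e0 rho0 k1 gk hk x y; wlog yx : x y / mdist y p <= mdist x p.
  move=> H; have [yx|/ltW xy] := leP (mdist y p) (mdist x p); first exact: H.
  by rewrite distrC metric_sym; exact: H.
rewrite /glue; set c := cutoff _ _ _; set c' := cutoff _ _ _.
have c0 : 0 <= c by exact: cutoff_ge0.
have c1 : c <= 1 by exact: cutoff_le1.
have -> : g p + c * (g x - g p) + (1 - c) * (h x - h p) -
    (g p + c' * (g y - g p) + (1 - c') * (h y - h p)) =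
  c * (g x - g y) + (1 - c) * (h x - h y) +
  (c - c') * ((g y - g p) - (h y - h p)) by ring.
have H1 : `|c * (g x - g y)| <= c * (k * mdist x y).
  by rewrite normrM ger0_norm// ler_wpM2l.
have H2 : `|(1 - c) * (h x - h y)| <= (1 - c) * (k * mdist x y).
  by rewrite normrM ger0_norm ?subr_ge0// ler_wpM2l// subr_ge0.
have H3 : `|(c - c') * ((g y - g p) - (h y - h p))| <= 2 * e * mdist x y.
  have gh : `|g y - g p - (h y - h p)| <= 2 * mdist y p.
    have := ler_normB (g y - g p) (h y - h p).
    have := is_lip_le k1 gk y p; have := is_lip_le k1 hk y p; lra.
  rewrite normrM (le_trans (ler_wpM2l (normr_ge0 _) gh))//.
  rewrite mulrCA -mulrA ler_pM2l//.
  have := @cutoff_var R e rho (mdist y p) (mdist x p) e0 rho0.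
  rewrite mdist_ge0 yx => /(_ isT) /le_trans; apply; rewrite ler_pM2l//.
  by rewrite lerBlDr metric_triangle.
have := ler_normD (c * (g x - g y) + (1 - c) * (h x - h y))
  ((c - c') * ((g y - g p) - (h y - h p))).
have := ler_normD (c * (g x - g y)) ((1 - c) * (h x - h y)).
lra.
Qed.

End glue.

(** * Iterated gluing and its limit *)

Section gluing_sequence.
Context {R : realType} {M : pointedMetricType R}.
Context (e rho C : nat -> R) (p v : nat -> M) (f : M -> R) (h : nat -> M -> R).
Context (e0 : forall t, 0 < e t) (rho0 : forall t, 0 < rho t).
Context (rho_small : forall t, rho t <= 2^-1 ^+ t).
Context (C1 : forall t, C t <= 1) (CS : forall t, C t + 2 * e t <= C t.+1).
Context (f0 : f point = 0) (fC : forall t, is_lip (C t) f).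
Context (hC : forall t, is_lip (C t) (h t)).
Context (point_out : forall t, rho t <= mdist point (p t)).
Context (p_out : forall s t, (s < t)%N -> rho t <= mdist (p s) (p t)).
Context (v_out : forall s t, (s < t)%N -> rho t <= mdist (v s) (p t)).
Context (v_in : forall t, mdist (v t) (p t) <= inner_radius (e t) (rho t)).
Implicit Types (A B : pred nat) (t : nat) (x : M).

(* Off the set [A], glueing [f] itself undoes, near [p t], the earlier patches:
   this is what makes the perturbations [glued A t - f] additive in [A] while
   keeping the Lipschitz constant at most [C t]. *)
Fixpoint glued A t : M -> R :=
  if t is t'.+1 then
    glue (e t') (rho t') (p t') (glued A t') (if A t' then h t' else f)
  else f.

Lemma glued_lip A t : is_lip (C t) (glued A t).
Proof.
elim: t => [|t IH]; first exact: fC.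
by apply: is_lip_le (CS t) _; apply: is_lip_glue => //; case: (A t).
Qed.

Lemma glued_point A t : glued A t point = 0.
Proof. by elim: t => //= t IH; rewrite glue_outer. Qed.

(** [glue] is linear in the pair of functions, and gluing [f] into [f] gives [f]. At each step the
    functions glued in have the same sum on both sides, [h t + f] or [f + f], because [A] and [B]
    are disjoint. *)
Lemma gluedU A B t x : (forall s, ~~ (A s && B s)) ->
  glued (predU A B) t x + f x = glued A t x + glued B t x.
Proof.
move=> AB; elim: t x => [//|t IH] x; rewrite /= /glue.
have := IH x; have := IH (p t); move: (AB t) => /=.
move: (cutoff _ _ _) => c; case: (A t) (B t) => [] []//= _ Hp Hx; nra.
Qed.

Lemma glued_step A t x : `|glued A t.+1 x - glued A t x| <= 2 * 2^-1 ^+ t.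
Proof.
apply: (@le_trans _ _ (2 * rho t)); last by rewrite ler_pM2l.
apply: glue_close => //; first exact: is_lip_le (glued_lip A t).
by case: (A t); [exact: is_lip_le (hC t)|exact: is_lip_le (fC t)].
Qed.

Lemma is_cvg_glued A x : cvg (glued A t x @[t --> \oo]).
Proof.
(* Since [w t - w t.+1] is the bound of [glued_step], subtracting [w] makes the sequence
   nondecreasing. *)
pose w t : R := 4 * 2^-1 ^+ t.
have w0 : w t @[t --> \oo] --> (0 : R).
  by apply: cvg_geometric; rewrite ger0_norm ?invr_ge0// invf_lt1// ltr1n.
have -> : (fun t => glued A t x) = (fun t => (glued A t x - w t) + w t).
  by apply/funext => t; rewrite subrK.
apply: is_cvgD; last by apply/cvg_ex; exists 0.
apply: nondecreasing_is_cvgn.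
  apply/nondecreasing_seqP => t; have := glued_step A t x.
  by rewrite /w exprS => /ler_normlP[]; lra.
exists (mdist x point) => _ [t _ <-]; have := is_lip_le (C1 t) (glued_lip A t).
move=> /(_ x point); rewrite glued_point subr0 mul1r => /ler_normlP[_].
have : 0 <= w t by rewrite mulr_ge0// exprn_ge0// invr_ge0.
lra.
Qed.

Definition glued_lim A x : R := lim (glued A t x @[t --> \oo]).

Lemma glued_lim_lip A : is_lip 1 (glued_lim A).
Proof.
move=> x y.
have c : `|glued A t x - glued A t y| @[t --> \oo] -->
    `|glued_lim A x - glued_lim A y|.
  by apply: cvg_norm; apply: cvgB; exact: is_cvg_glued.
rewrite -(cvg_lim _ c)//; apply: limr_le.
  by apply/cvg_ex; eexists; exact: c.
by apply: nearW => t; exact: is_lip_le (glued_lip A t) _ _.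
Qed.

Lemma glued_lim_const A T x :
  (forall t, (T <= t)%N -> rho t <= mdist x (p t)) ->
  glued_lim A x = glued A T x.
Proof.
move=> xT; apply: cvg_lim => //; apply: cvg_near_cst.
exists T => // t /= /subnK <-; elim: (t - T)%N => // k IH.
by rewrite addSn /= glue_outer ?IH// xT// leq_addl.
Qed.

Lemma glued_lim_point A : glued_lim A point = 0.
Proof. by rewrite (@glued_lim_const _ 0%N)// glued_point. Qed.

(** The patches after [t] miss [p t] and [v t], so the limit is already reached at [t.+1]; there
    both points lie in the inner ball, where the function is a translate of [h t]. *)
Lemma glued_lim_slope A t : A t ->
  glued_lim A (v t) - glued_lim A (p t) = h t (v t) - h t (p t).
Proof.
move=> At; rewrite !(@glued_lim_const _ t.+1)//= ?At.
- rewrite !glue_inner//; first by ring.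
  by rewrite mdistxx ltW// inner_radius_gt0.
- by move=> s; exact: p_out.
- by move=> s; exact: v_out.
Qed.

Lemma glued_limU A B x : (forall s, ~~ (A s && B s)) ->
  glued_lim (predU A B) x + f x = glued_lim A x + glued_lim B x.
Proof.
move=> AB; rewrite -[RHS](subrK (f x)); congr (_ + _).
rewrite /glued_lim (_ : (fun t => _) =
  (fun t => glued A t x + glued B t x - f x)); last first.
  by apply/funext => t; rewrite -gluedU// addrK.
apply: cvg_lim => //; apply: cvgB; last exact: cvg_cst.
by apply: cvgD; exact: is_cvg_glued.
Qed.

End gluing_sequence.

(** * Indexing and choice of the patches *)

(** A power of 5 makes the index large without affecting the exponents of 2 and 3. *)
Lemma logn23_frequently (n i k : nat) :
  exists t, [/\ (k <= t)%N, logn 2 t.+1 = n & logn 3 t.+1 = i].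
Proof.
have m0 : (0 < 2 ^ n * 3 ^ i * 5 ^ k)%N by rewrite !muln_gt0 !expn_gt0.
exists (2 ^ n * 3 ^ i * 5 ^ k).-1; rewrite prednK//; split.
- rewrite -ltnS prednK// (leq_trans (ltn_expl k (isT : 1 < 5)%N))//.
  by rewrite leq_pmull// muln_gt0 !expn_gt0.
- rewrite !lognM ?muln_gt0 ?expn_gt0// !lognX.
  by rewrite !logn_prime//= muln1 !muln0 !addn0.
- rewrite !lognM ?muln_gt0 ?expn_gt0// !lognX.
  by rewrite !logn_prime//= muln1 !muln0 addn0.
Qed.

(** Recursion on the finite list of the base point and all earlier pairs: [steep_points] gives [p t]
    outside this list, then [rho t] is taken at most the distances from the list to [p t], and
    finally [v t] is found in the inner ball. *)
Lemma gluing_points (R : realType) (M : pointedMetricType R)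
    (y : nat -> M -> R) (e r k : nat -> R) :
  length_space M -> (forall t, is_lip 1 (y t)) ->
  (forall t, 0 < k t) -> (forall t, ~ is_lip (k t) (y t)) ->
  (forall t, 0 < r t) ->
  exists (p v : nat -> M) (rho : nat -> R),
    [/\ forall t, [/\ 0 < rho t, rho t <= r t & rho t <= mdist point (p t)],
        forall s t, (s < t)%N -> rho t <= mdist (p s) (p t),
        forall s t, (s < t)%N -> rho t <= mdist (v s) (p t) &
        forall t, [/\ 0 < mdist (p t) (v t),
          mdist (v t) (p t) <= inner_radius (e t) (rho t) &
          k t * mdist (p t) (v t) <= y t (v t) - y t (p t)]].
Proof.
move=> lM y1 k0 yk r0.
have avoid (p : M) (F : seq M) r' : 0 < r' -> p \notin F ->
    exists2 rho, 0 < rho <= r' & forall q, q \in F -> rho <= mdist q p.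
  move=> r'0; elim: F => [_|q F IH]; first by exists r'; rewrite ?r'0/=.
  rewrite inE negb_or => /andP[pq /IH[rho /andP[rho0 rhor] rhoF]].
  exists (Num.min rho (mdist q p)).
    by rewrite lt_min rho0 mdist_gt0 eq_sym pq ge_min rhor.
  move=> q'; rewrite inE ge_min => /predU1P[->|/rhoF q'F].
    by rewrite lexx orbT.
  by rewrite q'F.
have /choice[z zP] : forall tF : nat * seq M, exists z : M * M * R,
    let t := tF.1 in let p := z.1.1 in let v := z.1.2 in let rho := z.2 in
    [/\ 0 < rho <= r t, forall q, q \in tF.2 -> rho <= mdist q p &
      [/\ 0 < mdist p v, mdist v p <= inner_radius (e t) rho &
        k t * mdist p v <= y t v - y t p]].
  move=> [t F] /=.
  have [p pF pv] := steep_points F lM (y1 t) (k0 t) (yk t).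
  have [rho /andP[rho0 rhor] rhoF] := avoid p F (r t) (r0 t) pF.
  have [v [v0 v1 v2]] := pv _ (inner_radius_gt0 (e t) rho0).
  exists (p, v, rho) => /=; split => //; first by rewrite rho0.
  by split => //; rewrite metric_sym ltW.
pose hist := fix hist t := if t is t'.+1 then
  let w := z (t', hist t') in w.1.1 :: w.1.2 :: hist t' else [:: point : M].
pose w t := z (t, hist t).
have hist_point t : (point : M) \in hist t.
  by elim: t => [|t IH]; rewrite /= !inE ?eqxx// IH !orbT.
have hist_pv s t : (s < t)%N -> (w s).1.1 \in hist t /\ (w s).1.2 \in hist t.
  elim: t => // t IH; rewrite ltnS leq_eqVlt => /predU1P[->|/IH[ps vs]].
    by rewrite /= !inE !eqxx !orbT.
  by rewrite /= !inE ps vs !orbT.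
exists (fun t => (w t).1.1), (fun t => (w t).1.2), (fun t => (w t).2); split.
- move=> t; have [/andP[? ?] H _] := zP (t, hist t); split => //.
  exact: H _ (hist_point t).
- by move=> s t /hist_pv[ps vs]; have [_ + _] := zP (t, hist t); apply.
- by move=> s t /hist_pv[ps vs]; have [_ + _] := zP (t, hist t); apply.
- by move=> t; have [_ _ +] := zP (t, hist t).
Qed.

(** * Bounded functionals and the Daugavet property *)

Lemma continuous_scalar_bounded (R : realType) (X : normedModType R)
    (phi : {scalar X}) : continuous (phi : X -> R) ->
  exists K, forall x, `|x| <= 1 -> `|phi x| <= K.
Proof.
move=> phic; have := phic 0; rewrite /continuous_at linear0.
move=> /cvgrPdist_lt/(_ _ ltr01) /nbhs_norm0P[r /= r0 H].
exists (2 / r) => x x1; have := H ((r / 2) *: x).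
rewrite /= normrZ gtr0_norm ?divr_gt0//.
have -> : r / 2 * `|x| < r.
  apply: (@le_lt_trans _ _ (r / 2)); last by lra.
  by rewrite ler_piMr// ltW// divr_gt0.
move=> /(_ isT); rewrite sub0r normrN linearZ/= normrM gtr0_norm ?divr_gt0//.
by rewrite ler_pdivlMr// mulrC => h; lra.
Qed.

Theorem theorem10p1 (R : realType) (M : completePointedMetricType R) :
  length_space M -> omega_perfect_Daugavet (Lip0 M).
Proof.
move=> lM y S y1 [phi [alpha [phic alpha0 ->]]].
have [K phiK] := continuous_scalar_bounded phic.
pose s := sup ((phi : _ -> R) @` @unit_ball R (Lip0 M)).
have hs : has_sup ((phi : _ -> R) @` @unit_ball R (Lip0 M)).
  split; first by exists (phi 0), 0 => //; rewrite /unit_ball/= normr0 ler01.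
  by exists K => _ [x x1 <-]; have /ler_normlP[] := phiK x x1.
have [_ [f0 f01 <-] phif0] := sup_adherent alpha0 hs.
pose mu0 := phi f0 - (s - alpha); have mu00 : 0 < mu0 by rewrite subr_gt0.
have D0 : 0 < mu0 + `|phi f0| by rewrite ltr_wpDr.
have D1 : 0 < mu0 + `|phi f0| + 1 by rewrite addr_gt0.
(* Small enough that [(1 - dl) *: f0] stays in the slice; the summand 1 gives [dl < 1] even if
   [phi f0 = 0]. *)
pose dl := mu0 / (mu0 + `|phi f0| + 1).
have dl0 : 0 < dl by rewrite divr_gt0.
have dl1 : dl < 1.
  by rewrite ltr_pdivrMr// mul1r; have := normr_ge0 (phi f0); lra.
have dlphi : dl * `|phi f0| < mu0.
  by rewrite mulrAC ltr_pdivrMr// ltr_pM2l//; lra.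
pose f : Lip0 M := (1 - dl) *: f0.
pose mu := phi f - (s - alpha).
have mu_gt0 : 0 < mu.
  rewrite /mu /f linearZ/= mulrBl mul1r.
  have := ler_wpM2l (ltW dl0) (ler_norm (phi f0)).
  by move: dlphi; rewrite /mu0; lra.
have half01 t : 0 < (2^-1 : R) ^+ t <= 1.
  by rewrite exprn_gt0 ?invr_gt0// exprn_ile1// ?invr_ge0// invf_le1// ler1n.
(* The constants rise from [1 - dl], which bounds the norm of [f], towards 1; [e t] is half of the
   increment [C t.+1 - C t]. *)
pose C t := 1 - dl * 2^-1 ^+ t; pose e t := dl * 2^-1 ^+ t.+2.
have dlt t : 0 < dl * 2^-1 ^+ t <= dl.
  have /andP[h0 h1] := half01 t; rewrite mulr_gt0//= ler_piMr//; exact: ltW.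
have C0 t : 0 < C t by have := dlt t; rewrite /C; lra.
have C1 t : C t < 1 by have := dlt t; rewrite /C; lra.
have e0 t : 0 < e t by have := dlt t.+2; rewrite /e; lra.
have CS t : C t + 2 * e t <= C t.+1.
  by rewrite /C /e !exprS; lra.
pose n t := logn 2 t.+1.
have yl t : is_lip 1 (y (n t)) by rewrite -[1](y1 (n t)); exact: lip_normP.
have yk t : ~ is_lip (C t) (y (n t)).
  move=> /(lip_norm_le (ltW (C0 t))); rewrite -lip0_normE y1 leNgt.
  by rewrite C1.
have [p [v [rho [Hrho p_out v_out Hv]]]] :=
  gluing_points e lM yl C0 yk (fun t => proj1 (andP (half01 t))).
have rho0 t : 0 < rho t by have [] := Hrho t.
have rho_small t : rho t <= 2^-1 ^+ t by have [] := Hrho t.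
have point_out t : rho t <= mdist point (p t) by have [] := Hrho t.
have v_in t : mdist (v t) (p t) <= inner_radius (e t) (rho t).
  by have [] := Hv t.
pose h t x := C t * y (n t) x.
have hC t : is_lip (C t) (h t).
  move=> a b; rewrite /h -mulrBr normrM gtr0_norm// ler_pM2l//.
  by have := yl t a b; rewrite mul1r.
have fC t : is_lip (C t) f.
  apply: (@is_lip_le _ _ (1 - dl)); first by have := dlt t; rewrite /C; lra.
  move=> a b; rewrite [f a]/((1 - dl) * f0 a) [f b]/((1 - dl) * f0 b).
  rewrite -mulrBr normrM gtr0_norm ?subr_gt0// ler_pM2l ?subr_gt0//.
  rewrite (le_trans (lip_normP f0 a b))// ler_piMl// ?mdist_ge0//.
have C1' t : C t <= 1 by rewrite ltW.
pose G (A : pred nat) := glued_lim e rho p f h A.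
have Glip A : is_lip 1 (G A).
  by apply: (@glued_lim_lip _ _ e rho C) => //; exact: lip0_point.
have GP A : (G A : M -> R^o) \in @lip0_pred R M.
  rewrite inE/=; split; last by exists 1.
  by apply: (@glued_lim_point _ _ e rho) => //; exact: lip0_point.
pose D A : Lip0 M := MkLip0 (GP A).
have D_le1 A : `|D A| <= 1.
  by rewrite lip0_normE; apply: lip_norm_le => //; exact: Glip.
have DU A B : (forall t, ~~ (A t && B t)) ->
    phi (D (predU A B)) = phi (D A) + phi (D B) - phi f.
  move=> AB; apply/eqP; rewrite eq_sym subr_eq eq_sym -!linearD; apply/eqP.
  congr (phi _); apply: lip0P => x.
  apply: (@glued_limU _ _ e rho C p f h) => //; exact: lip0_point.
(* The exponents of 2 and 3 in [t.+1] say which [y n] the patch [t] serves and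
   to which family it belongs. *)
pose A_ i t := logn 3 t.+1 == i.
have [i Ai] : exists i, s - alpha < phi (D (A_ i)).
  apply: contrapT => H.
  have Hi i : phi (D (A_ i)) <= phi f - mu.
    by rewrite /mu subKr leNgt; apply/negP => Hi; apply: H; exists i.
  pose B_ N t := (logn 3 t.+1 < N)%N.
  (* Each family outside the slice lowers [phi] by at least [mu] relative to [f]. By [DU] these
     losses add up, while [D (B_ N)] stays in the unit ball, where [phi] is at least [- K]. *)
  have HB N : phi (D (B_ N)) <= K - mu *+ N.
    elim: N => [|N IH].
      rewrite mulr0n subr0; by have /ler_normlP[] := phiK _ (D_le1 (B_ 0%N)).
    have -> : B_ N.+1 = predU (B_ N) (A_ N).
      by apply/funext => t; rewrite /B_ /A_ /= ltnS leq_eqVlt orbC.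
    rewrite DU; first by have := Hi N; rewrite mulrSr; lra.
    move=> t; rewrite /B_ /A_; apply/negP => /andP[tN /eqP tE].
    by rewrite tE ltnn in tN.
  have K0 : 0 <= K by apply: le_trans (phiK f0 f01).
  have K2 : 0 <= (2 * K) / mu by rewrite divr_ge0 ?mulr_ge0// ltW.
  have := archi_boundP K2; set N := Num.bound _.
  rewrite ltr_pdivrMr// mulr_natl => KN.
  have := HB N; have /ler_normlP[+ _] := phiK _ (D_le1 (B_ N)); lra.
exists (D (A_ i)); first by split => //; exact: D_le1.
move=> m; apply/eqP; rewrite eq_le; apply/andP; split.
  by rewrite (le_trans (ler_normD _ _))// y1 -[leRHS]/(1 + 1) lerD2l.
rewrite leNgt; apply/negP => lt2.
set w := `|_| in lt2; pose gap := 2 - w.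
have gap0 : 0 < gap by rewrite subr_gt0.
have g3 : 0 <= 3 / gap by rewrite divr_ge0// ltW.
have := archi_boundP g3; set k := Num.bound _ => kgap.
have [t [kt nt it]] := logn23_frequently m i k.
have [d0 _ dC] := Hv t.
have slope : G (A_ i) (v t) - G (A_ i) (p t) = h t (v t) - h t (p t).
  apply: (@glued_lim_slope _ _ e rho p v) => //.
  by rewrite /A_ it.
have := lip_normP (y m + D (A_ i)) (v t) (p t).
rewrite -lip0_normE -/w metric_sym.
rewrite [X in `|X - _|]/(y m (v t) + G (A_ i) (v t)).
rewrite [X in `|_ - X|]/(y m (p t) + G (A_ i) (p t)).
rewrite opprD addrACA slope /h /n nt -mulrBr -{1}[y m _ - _]mul1r -mulrDl.
have C0' : 0 < 1 + C t by exact: addr_gt0 ltr01 (C0 t).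
rewrite normrM (gtr0_norm C0').
rewrite /n nt in dC => wd.
(* Between [p t] and [v t] the sum varies like [(1 + C t) * y m], and [y m] has slope at least [C t]
   there. *)
have wC : (1 + C t) * C t <= w.
  rewrite -(ler_pM2r d0); apply: le_trans wd.
  rewrite -mulrA (ler_pM2l C0').
  by rewrite (le_trans dC)// ler_norm.
(* With [u = dl * 2^-1 ^+ t], the bound [wC] reads [2 - 3 * u + u ^+ 2 <= w]. *)
have : gap <= 3 * 2^-1 ^+ t.
  have u1 : dl * 2^-1 ^+ t <= 2^-1 ^+ t.
    by rewrite ler_piMl ?(ltW dl1)//; have /andP[/ltW] := half01 t.
  have : 0 <= (dl * 2^-1 ^+ t) ^+ 2 by rewrite exprn_even_ge0.
  move: wC; rewrite /gap /C expr2; move: (dl * _) u1 => u u1; nra.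
rewrite leNgt => /negP; apply.
rewrite exprVn ltr_pdivrMr ?exprn_gt0// -ltr_pdivrMl// mulrC.
rewrite (lt_le_trans kgap)// -natrX ler_nat.
by rewrite (leq_trans kt)// ltnW// ltn_expl.
Qed.
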